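(* Let $j,m\ge0$ be integers and consider pairs $(k,n)$ with $1\le k\le n$. The polynomials $p_{(k,n)}(q)$ take the forms $$p_{(2j,2m)}(q)=p_{(2j,2m+1)}(q)=p_{(2j+1,2m+1)}(q)=\begin{bmatrix}m\\ j\end{bmatrix}_{q^2},$$ $$p_{(2j+1,2m)}(q)=(1-q^m)\begin{bmatrix}m-1\\ j\end{bmatrix}_{q^2}.$$
   Context: $\begin{bmatrix}m\\ j\end{bmatrix}_{x}=\frac{[m]_x!}{[j]_x!\,[m-j]_x!}$ is the Gaussian binomial coefficient, where $[i]_x=(1-x^i)/(1-x)$ and $[i]_x!=[i]_x\cdots[1]_x$. Definition of $p_{(k,n)}(q)$: let $\mathcal{S}_n^{(k)}$ be the set of minimal length representatives of $\mathcal{S}_n/\langle s_i:i\neq k\rangle$, identified with the Schubert symbols $\sigma=(\sigma_1,\ldots,\sigma_k)$, $1\le\sigma_1<\cdots<\sigma_k\le n$; the length of the element $w_\sigma$ is $l(w_\sigma)=\sum_{i=1}^k(\sigma_i-i)$, and $e=(1,2,\ldots,k)$. Define signs $\epsilon_i=(-1)^{\lfloor i/2\rfloor}$ if $k$ is odd and $\epsilon_i=(-1)^{\lfloor(i-1)/2\rfloor}$ if $k$ is even ($1\le i\le n$), and $\epsilon(\sigma)=\prod_{i=1}^k\epsilon_{\sigma_i}$. Whenever $\sigma'$ is obtained from $\sigma$ by replacing one entry $\sigma_i$ by $\sigma_i+1$ (the result again being a Schubert symbol), write $\sigma\Rightarrow\sigma'$ if $\epsilon(\sigma)=\epsilon(\sigma')$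 and $\sigma\to\sigma'$ if $\epsilon(\sigma)=-\epsilon(\sigma')$. Let $\eta$ be the unique function on the Schubert symbols such that (i) $\eta(e)=0$; (ii) $\eta(\sigma')=\eta(\sigma)$ if $\sigma\Rightarrow\sigma'$; (iii) $\eta(\sigma')=\eta(\sigma)+1$ if $\sigma\to\sigma'$. Then $$p_{(k,n)}(q)=\sum_{w\in\mathcal{S}_n^{(k)}}(-1)^{l(w)}q^{\eta(w)}.$$ *)

(* Defs.v *)
From HB Require Import structures.
From mathcomp Require Import all_boot all_order all_algebra.

Set Implicit Arguments.
Unset Strict Implicit.
Unset Printing Implicit Defensive.

Import GRing.Theory.
Local Open Scope ring_scope.

Definition is_schubert (k n : nat) (s : {ffun 'I_k -> 'I_n.+1}) : bool :=
  [forall i : 'I_k, 1 <= s i]%N &&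
  [forall i : 'I_k, forall j : 'I_k, (i < j)%N ==> (s i < s j)%N].

(* Schubert symbols 1 <= s_1 < ... < s_k <= n. The entries are 1-based, as in
   the usual notation, but the positions i : 'I_k are 0-based: the entry at
   i : 'I_k is the one usually written s_(i+1). *)
Structure schubert (k n : nat) := Schubert {
  entries :> {ffun 'I_k -> 'I_n.+1};
  entriesP : is_schubert entries }.

HB.instance Definition _ k n := [isSub for @entries k n].
HB.instance Definition _ k n := [Finite of schubert k n by <:].

(* The symbol e = (1, 2, ..., k). *)
Definition is_base (k n : nat) (s : schubert k n) : bool :=
  [forall i : 'I_k, s i == i.+1 :> nat].

(* l(w_s), the sum of the s_i - i. The truncated subtraction is exact, since
   s_i >= i for a Schubert symbol (lemma entry_ge). *)
Definition len (k n : nat) (s : schubert k n) : nat :=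
  (\sum_(i < k) (s i - i.+1))%N.

Definition eps (k i : nat) : int :=
  if odd k then (-1) ^+ i./2 else (-1) ^+ i.-1./2.

Definition eps_symb (k n : nat) (s : schubert k n) : int :=
  \prod_(i < k) eps k (s i).

Definition step (k n : nat) (s s' : schubert k n) : bool :=
  [exists i : 'I_k, [forall j : 'I_k, s' j == (s j + (j == i))%N :> nat]].

(* s => s' *)
Definition dbl_arrow (k n : nat) (s s' : schubert k n) : bool :=
  step s s' && (eps_symb s == eps_symb s').

(* s -> s' *)
Definition arrow (k n : nat) (s s' : schubert k n) : bool :=
  step s s' && (eps_symb s == - eps_symb s').

Definition is_eta (k n : nat) (f : {ffun schubert k n -> nat}) : bool :=
  [&& [forall s, is_base s ==> (f s == 0%N)],
      [forall s, forall s', dbl_arrow s s' ==> (f s' == f s)]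
    & [forall s, forall s', arrow s s' ==> (f s' == (f s).+1)]].

Lemma entry_lt k n (s : schubert k n) (i j : 'I_k) : (i < j)%N -> (s i < s j)%N.
Proof. by case/andP: (entriesP s) => _ /forallP/(_ i)/forallP/(_ j)/implyP. Qed.

Lemma entry_ge k n (s : schubert k n) (i : 'I_k) : (i < s i)%N.
Proof.
case: i => i; elim: i => [|i IHi] lt_ik.
  by case/andP: (entriesP s) => /forallP/(_ (Ordinal lt_ik)).
apply: leq_ltn_trans (IHi (ltnW lt_ik)) _.
exact: (@entry_lt _ _ s (Ordinal (ltnW lt_ik)) (Ordinal lt_ik) (ltnSn i)).
Qed.

Lemma eps_sqr k i : eps k i * eps k i = 1.
Proof. by rewrite /eps; case: ifP => _; rewrite -expr2 sqrr_sign. Qed.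

Lemma eps_cases k i : eps k i = 1 \/ eps k i = - 1.
Proof.
by rewrite /eps; case: ifP => _; rewrite -signr_odd; case: odd; rewrite ?expr0; auto.
Qed.

Lemma eps_symb_cases k n (s : schubert k n) :
  eps_symb s = 1 \/ eps_symb s = - 1.
Proof.
rewrite /eps_symb; elim/big_ind: _ => [|x y|i _]; [by left | | exact: eps_cases].
by case=> -> [] ->; rewrite ?mulN1r ?opprK ?mul1r; auto.
Qed.

Lemma step_eps k n (s s' : schubert k n) (i : 'I_k) :
    (forall j : 'I_k, s' j = (s j + (j == i))%N :> nat) ->
  eps_symb s' = eps_symb s * (eps k (s i) * eps k (s i).+1).
Proof.
move=> s'E; rewrite /eps_symb (bigD1 i) //= [in RHS](bigD1 i) //=.
rewrite s'E eqxx addn1 mulrACA eps_sqr mul1r mulrC; congr (_ * _).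
by apply: eq_bigr => j /negPf ne_ji; rewrite s'E ne_ji addn0.
Qed.

Lemma eta_exists k n : exists f : {ffun schubert k n -> nat}, is_eta f.
Proof.
pose c v : nat := eps k v != eps k v.+1.
pose h (i : 'I_k) x := (\sum_(i.+1 <= v < x) c v)%N.
exists [ffun s : schubert k n => \sum_(i < k) h i (s i)]%N.
have hstep (s s' : schubert k n) (i : 'I_k) :
    (forall j : 'I_k, s' j = (s j + (j == i))%N :> nat) ->
  (\sum_(j < k) h j (s' j) = \sum_(j < k) h j (s j) + c (s i))%N.
  move=> s'E; rewrite (bigD1 i) //= [in RHS](bigD1 i) //= s'E eqxx addn1.
  rewrite {1}/h big_nat_recr ?entry_ge //= -/(h i (s i)) addnAC; congr (_ + _ + _)%N.
  by apply: eq_bigr => j /negPf ne_ji; rewrite s'E ne_ji addn0.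
have sgn_neq (x : int) : x = 1 \/ x = - 1 -> (x == - x) = false by case=> ->.
apply/and3P; split; apply/forallP => s.
- apply/implyP => /forallP sE; rewrite ffunE big1 // => i _.
  by rewrite (eqP (sE i)) /h big_geq.
- apply/forallP => s'; apply/implyP => /andP[/existsP[i /forallP s'E] eE].
  have {}s'E j := eqP (s'E j).
  move: eE; rewrite !ffunE (hstep _ _ _ s'E) (step_eps s'E) /c.
  case: (eps_cases k (s i)) => ->; case: (eps_cases k (s i).+1) => ->;
    rewrite ?mulN1r ?mul1r ?opprK ?mulr1 ?mulrN1 ?eqxx ?addn0 //;
    by rewrite sgn_neq //; apply: eps_symb_cases.
apply/forallP => s'; apply/implyP => /andP[/existsP[i /forallP s'E] eE].
have {}s'E j := eqP (s'E j).
move: eE; rewrite !ffunE (hstep _ _ _ s'E) (step_eps s'E) /c.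
case: (eps_cases k (s i)) => ->; case: (eps_cases k (s i).+1) => ->;
  rewrite ?mulN1r ?mul1r ?opprK ?mulr1 ?mulrN1 ?eqxx ?addn1 //;
  by rewrite sgn_neq //; apply: eps_symb_cases.
Qed.

Lemma step_pred k n (s : schubert k n) :
  ~~ is_base s -> exists s0 : schubert k n, step s0 s.
Proof.
rewrite negb_forall => /existsP[i0 ne0].
case: (@arg_minnP _ i0 (fun i => (s i : nat) != i.+1) (fun i => i : nat) ne0).
move=> i ne_i min_i.
have gt_i : (i.+1 < s i)%N by rewrite ltn_neqAle eq_sym ne_i entry_ge.
have lt_n (j : 'I_k) : (s j - (j == i) < n.+1)%N by apply: leq_ltn_trans (leq_subr _ _) _.
pose t := [ffun j => Ordinal (lt_n j)] : {ffun 'I_k -> 'I_n.+1}.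
have tE j : t j = (s j - (j == i))%N :> nat by rewrite ffunE.
have tP : is_schubert t.
  apply/andP; split; apply/forallP => a.
    rewrite tE; case: eqP => [->|_]; last by rewrite subn0 (leq_ltn_trans _ (entry_ge s a)).
    by rewrite subn_gt0 (leq_ltn_trans _ gt_i).
  apply/forallP => b; apply/implyP => lt_ab; rewrite !tE.
  have [eb|_] := eqVneq b i; last first.
    by rewrite subn0 (leq_ltn_trans (leq_subr _ _)) // entry_lt.
  subst b; have -> : (a == i) = false by apply/eqP => ea; rewrite ea ltnn in lt_ab.
  rewrite subn0; have /eqP-> : (s a : nat) == a.+1.
    by apply: contraTT lt_ab => /min_i; rewrite -leqNgt.
  by rewrite ltn_subRL add1n (leq_ltn_trans _ gt_i).
exists (Schubert tP); apply/existsP; exists i; apply/forallP => j /=.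
rewrite tE subnK //; case: eqP => // _.
exact: leq_ltn_trans (entry_ge s j).
Qed.

Lemma eta_unique k n (f g : {ffun schubert k n -> nat}) :
  is_eta f -> is_eta g -> f = g.
Proof.
case/and3P=> /forallP f0 /forallP f1 /forallP f2.
case/and3P=> /forallP g0 /forallP g1 /forallP g2.
apply/ffunP => s.
have [N] := ubnP (\sum_(i < k) s i)%N; elim: N s => // N IHN s ltN.
have [sE | /step_pred[s0 s0s]] := boolP (is_base s).
  by rewrite (eqP (implyP (f0 s) sE)) (eqP (implyP (g0 s) sE)).
have {}IHN : f s0 = g s0.
  apply: IHN; apply: leq_trans _ (ltN : (_ <= N)%N).
  case/existsP: s0s => i /forallP sE; rewrite (bigD1 i) //= [leqRHS](bigD1 i) //=.
  rewrite (eqP (sE i)) eqxx addn1 ltnS leq_add2l.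
  by apply: leq_sum => j /negPf ne_ji; rewrite (eqP (sE j)) leq_addr.
have [eE | neE] := boolP (eps_symb s0 == eps_symb s).
  have a : dbl_arrow s0 s by apply/andP.
  by rewrite (eqP (implyP (forallP (f1 s0) s) a)) (eqP (implyP (forallP (g1 s0) s) a)).
have a : arrow s0 s.
  apply/andP; split=> //; move: neE.
  by case: (eps_symb_cases s0) => ->; case: (eps_symb_cases s) => ->.
by rewrite (eqP (implyP (forallP (f2 s0) s) a)) (eqP (implyP (forallP (g2 s0) s) a)) IHN.
Qed.

(* By eta_unique, the only function satisfying is_eta. *)
Definition eta (k n : nat) : {ffun schubert k n -> nat} :=
  xchoose (eta_exists k n).

Lemma etaP k n : is_eta (eta k n).
Proof. exact: xchooseP. Qed.

Definition p (k n : nat) : {poly int} :=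
  \sum_(s : schubert k n) (-1) ^+ len s * 'X^(eta k n s).

Definition qint (F : fieldType) (x : F) (i : nat) : F := (1 - x ^+ i) / (1 - x).

Definition qfact (F : fieldType) (x : F) (i : nat) : F :=
  \prod_(1 <= l < i.+1) qint x l.

(* For j <= m only, because of the truncated m - j; and x must not be a root
   of unity, for the denominators not to vanish. *)
Definition qbinom (F : fieldType) (x : F) (m j : nat) : F :=
  qfact x m / (qfact x j * qfact x (m - j)).

(* The indeterminate q and polynomials in q, in the field of fractions of
   Z[q], where the quotients defining the Gaussian binomials make sense. *)
Definition q : {fraction {poly int}} := tofrac 'X.
Definition pq (k n : nat) : {fraction {poly int}} := tofrac (p k n).

(* Main.v *)
Require Import Defs.
From mathcomp Require Import all_boot all_order all_algebra.
From mathcomp Require Import zify ring.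
Local Open Scope ring_scope.

Set Implicit Arguments.
Unset Strict Implicit.
Unset Printing Implicit Defensive.

Import GRing.Theory.

(** The sign eps_x is -1 to the power h(x), where h(x) is [eps_exp k x], and h
    grows by 0 or 1 when x grows by 1. Hence both statistics are additive over the
    entries of a symbol: up to their values on the base symbol e = (1, ..., k),
    the length is the sum of the entries s_i and eta is the sum of the h(s_i)
    ([lenE], [etaE]). So, with the weights a_x = (-1)^x q^h(x), the polynomial
    p_(k,n) times a_1 ... a_k is the sum over symbols of the products of the
    a_(s_i), that is, the k-th elementary symmetric function of a_1, ..., a_n
    ([sum_schubert], [pq_coef]): it is the coefficient of X^k in the product of
    the 1 + a_x X for 1 <= x <= n.

    Since h is constant on pairs of consecutive integers, the factors of such a
    pair are conjugate, and they multiply to 1 - q^(2i) X^2. For k even the pairs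
    are (1,2), (3,4), ..., with i = 0, 1, ...; for n odd one linear factor is left
    over, which does not affect the coefficients of even degree. For k odd, the
    factor 1 - X of x = 1 comes first, followed by the pairs (2,3), (4,5), ...,
    with i = 1, 2, ...; for n = 2m a factor 1 + q^m X is left over, and the odd part
    of (1 - X)(1 + q^m X) is -(1 - q^m) X, which explains the factor 1 - q^m. In all
    cases the q-binomial theorem ([coef_prod_geom]) in the variable X^2, with base
    q^2, gives the Gaussian binomial, multiplied by the product a_1 ... a_k that the
    normalisation removes. *)

(** * Gaussian binomials *)

Section Qbinomial.
Context (F : fieldType) (x : F).
Hypothesis x_nonroot : forall i, (0 < i)%N -> 1 - x ^+ i != 0.

Lemma qint_neq0 i : (0 < i)%N -> qint x i != 0.
Proof.
move=> i_gt0; rewrite mulf_neq0 ?invr_eq0 ?x_nonroot //.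
by have := x_nonroot (ltn0Sn 0); rewrite expr1.
Qed.

Lemma qfactS i : qfact x i.+1 = qfact x i * qint x i.+1.
Proof. by rewrite /qfact big_nat_recr. Qed.

Lemma qfact_neq0 i : qfact x i != 0.
Proof.
elim: i => [|i IHi]; first by rewrite /qfact big_geq ?oner_eq0.
by rewrite qfactS mulf_neq0 ?qint_neq0.
Qed.

Lemma qbinom0 m : qbinom x m 0 = 1.
Proof. by rewrite /qbinom subn0 {2}/qfact big_geq // mul1r divff ?qfact_neq0. Qed.

Lemma qbinomn m : qbinom x m m = 1.
Proof. by rewrite /qbinom subnn {3}/qfact big_geq // mulr1 divff ?qfact_neq0. Qed.

Lemma qintD a b : qint x (a + b) = qint x a + x ^+ a * qint x b.
Proof. by rewrite /qint exprD mulrA -mulrDl mulrBr mulr1 addrA subrK. Qed.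

(** This Pascal rule comes from splitting the q-integer of m + 1 as that of m - j
    plus x ^ (m - j) times that of j + 1. *)
Lemma qbinomS m j : (j < m)%N ->
  qbinom x m.+1 j.+1 = qbinom x m j.+1 + x ^+ (m - j) * qbinom x m j.
Proof.
move=> lt_jm; have [d mE] : exists d, m = (d.+1 + j)%N.
  by exists (m - j.+1)%N; rewrite addSnnS subnK.
have e1 : (d.+1 + j - j.+1 = d)%N by rewrite addSnnS addnK.
rewrite /qbinom mE subSS addnK e1 !qfactS -addnS qintD.
have nz := (qfact_neq0, qint_neq0).
by field; rewrite !nz.
Qed.

(** The q-binomial theorem. Keeping the coefficient of [qbinom] as a product,
    rather than as y ^ j * x ^ (j * (j - 1) / 2), makes it, up to sign, the
    product of the weights of the base symbol. Induction on [m] multiplies by the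
    last factor, which matches [qbinomS]; the top coefficient is separate because [qbinom] is meaningful only for j <= m. *)
Lemma coef_prod_geom (y : F) m j : (j <= m)%N ->
  (\prod_(i < m) (1 + (y * x ^+ i) *: 'X))`_j
    = (\prod_(i < j) (y * x ^+ i)) * qbinom x m j.
Proof.
pose P m := \prod_(i < m) (1 + (y * x ^+ i) *: 'X) : {poly F}.
have PS l i : (P l.+1)`_i
    = (P l)`_i + y * x ^+ l * (if i == 0%N then 0 else (P l)`_i.-1).
  by rewrite /P big_ord_recr /= mulrDr mulr1 coefD -scalerAr coefZ coefMX.
have P_gt : forall l i, (l < i)%N -> (P l)`_i = 0.
  elim=> [|l IHl] [|i] //; first by rewrite /P big_ord0 coefC.
  by rewrite ltnS => lt_li; rewrite PS /= !IHl ?mulr0 ?addr0 // ltnW.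
rewrite -/(P m); elim: m j => [|m IHm] [|j].
- by rewrite /P !big_ord0 coefC qbinom0 mulr1.
- by [].
- by move=> _; rewrite PS IHm // !qbinom0 mulr0 addr0.
rewrite ltnS PS /= leq_eqVlt => /predU1P[->|lt_jm].
  by rewrite P_gt // IHm // !qbinomn add0r !mulr1 big_ord_recr mulrC.
rewrite !IHm // ?(ltnW lt_jm) // qbinomS // big_ord_recr /=.
rewrite -[in x ^+ m](subnK (ltnW lt_jm)) exprD.
by ring.
Qed.

End Qbinomial.

(** * Schubert symbols and elementary symmetric functions *)

Lemma sorted_enum_ord n (A : {set 'I_n}) : sorted ltn (map val (enum A)).
Proof.
rewrite sorted_map {1}/enum_mem; apply: sorted_filter.
  by move=> a b c; apply: ltn_trans.
by rewrite -sorted_map -enumT val_enum_ord iota_ltn_sorted.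
Qed.

(** A Schubert symbol and its set of entries determine each other, which turns
    sums over symbols into sums over subsets. *)
Definition support k n (s : schubert k n) : {set 'I_n.+1} := [set s i | i : 'I_k].

Lemma entry_inj k n (s : schubert k n) : injective s.
Proof.
move=> i j eq_s; apply/val_inj.
by case: (ltngtP i j) => // /(entry_lt s); rewrite eq_s ltnn.
Qed.

Lemma support_inj k n : injective (@support k n).
Proof.
move=> s t eq_st.
(* A strictly increasing sequence is determined by its set of values. *)
have sorted_entries (r : schubert k n) : sorted ltn [seq val (r i) | i <- enum 'I_k].
  rewrite sorted_map; apply: (@sub_sorted _ (relpre val ltn)).
    by move=> i j; apply: entry_lt.
  by rewrite -sorted_map val_enum_ord iota_ltn_sorted.
have eq_map : [seq val (s i) | i <- enum 'I_k] = [seq val (t i) | i <- enum 'I_k].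
  apply: (irr_sorted_eq ltn_trans ltnn) => // v.
  have memE (r : schubert k n) :
      (v \in [seq val (r i) | i <- enum 'I_k]) = (v \in [seq val u | u in support r]).
    apply/mapP/imageP => [[i _ ->] | [_ /imsetP[i _ ->] ->]].
      by exists (r i); rewrite ?imset_f.
    by exists i; rewrite ?mem_enum.
  by rewrite !memE eq_st.
apply/val_inj/ffunP => i; apply/val_inj.
by move/eq_in_map: eq_map => /(_ i); apply; rewrite mem_enum.
Qed.

Lemma support_surj k n (A : {set 'I_n.+1}) : #|A| = k -> ord0 \notin A ->
  exists s : schubert k n, support s = A.
Proof.
move=> cardA A0.
pose t := [ffun i : 'I_k => nth ord0 (enum A) i].
have sz : size (enum A) = k by rewrite -cardE.
have tA i : t i \in A by rewrite ffunE -mem_enum mem_nth ?sz.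
have t_incr (i j : 'I_k) : (i < j)%N -> (t i < t j)%N.
  move=> lt_ij; rewrite !ffunE -!(nth_map ord0 0%N val) ?sz //.
  by apply: (sorted_ltn_nth ltn_trans 0%N (sorted_enum_ord A)); rewrite ?inE ?size_map ?sz.
have tP : is_schubert t.
  apply/andP; split; apply/forallP => i; last first.
    by apply/forallP => j; apply/implyP/t_incr.
  by rewrite lt0n; apply: contraNneq A0 => t0; rewrite -(_ : t i = ord0) //; apply/val_inj.
exists (Schubert tP); apply/eqP; rewrite eqEcard; apply/andP; split.
  by apply/subsetP => _ /imsetP[i _ ->]; apply: tA.
by rewrite card_imset ?card_ord ?cardA //; apply: (@entry_inj _ _ (Schubert tP)).
Qed.

(** Both sides are the [k]-th elementary symmetric function of a_1, ..., a_n: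
    expanding the product chooses a subset of the factors, and the coefficient of
    X ^ k keeps the subsets of size [k]. *)
Lemma sum_schubert (R : comNzRingType) (a : nat -> R) k n :
  \sum_(s : schubert k n) \prod_(i < k) a (s i)
    = (\prod_(x < n) (1 + a x.+1 *: 'X))`_k.
Proof.
(* The entries live in 0..n; giving 0 the weight 0 discards the subsets
   containing it. *)
pose b (x : 'I_n.+1) := if x == ord0 then 0 else a x.
have -> : \prod_(x < n) (1 + a x.+1 *: 'X) = \prod_(x < n.+1) (b x *: 'X + 1) :> {poly R}.
  rewrite big_ord_recl /b eqxx scale0r add0r mul1r.
  by apply: eq_bigr => x _; rewrite addrC.
rewrite bigA_distr coef_sum.
have coefJ (J : {set 'I_n.+1}) :
    (\prod_x (if x \in J then b x *: 'X else 1))`_k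
      = if (#|J| == k) && (ord0 \notin J) then \prod_(x in J) a x else 0.
  rewrite -big_mkcond scaler_prod prodr_const coefZ coefXn eq_sym.
  case: eqP => _; last by rewrite mulr0.
  rewrite mulr1; case: (boolP (ord0 \in J)) => /= J0.
    by rewrite (bigD1 ord0) //= /b eqxx mul0r.
  by apply: eq_bigr => x xJ; rewrite /b; case: eqP xJ J0 => // -> ->.
rewrite (eq_bigr _ (fun J _ => coefJ J)) -big_mkcond /=.
transitivity (\sum_(s : schubert k n) \prod_(x in support s) a x).
  apply: eq_bigr => s _; rewrite big_imset //= => i j _ _; exact: entry_inj.
rewrite -(big_imset (fun J : {set 'I_n.+1} => \prod_(x in J) a x)) /=; last first.
  by move=> s t _ _; apply: support_inj.
apply: eq_bigl => J; apply/imsetP/andP => [[s _ ->] | [/eqP cardJ J0]].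
  split; first by rewrite card_imset ?card_ord //; apply: entry_inj.
  by apply/imsetP => -[i _ /(congr1 val)/= s0]; have := entry_ge s i; rewrite -s0.
by have [s <-] := support_surj cardJ J0; exists s.
Qed.

(** * The statistics as sums over the entries *)

(** The exponent of -1 in [eps] counts the sign changes of [eps k] between 1 and x,
    so this integer carries more than its parity: [eta] is a sum of such counts. *)
Definition eps_exp k x := if odd k then x./2 else x.-1./2.

Lemma eps_expE k x : eps k x = (-1) ^+ eps_exp k x.
Proof. by rewrite /eps /eps_exp; case: ifP. Qed.

Lemma eps_expS k x : (0 < x)%N -> exists b : bool, eps_exp k x.+1 = (eps_exp k x + b)%N.
Proof.
have halfS y : y.+1./2 = (y./2 + odd y)%N by rewrite addnC -uphalf_half.
rewrite /eps_exp; case: x => // x _.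
by case: odd; [exists (odd x.+1) | exists (odd x)]; apply: halfS.
Qed.

Lemma leq_eps_exp k : {homo eps_exp k : x y / (x <= y)%N}.
Proof.
move=> x y le_xy; rewrite /eps_exp; case: odd; apply: half_leq => //.
by rewrite -!subn1 leq_sub2r.
Qed.

Lemma eps_symbE k n (s : schubert k n) :
  eps_symb s = (-1) ^+ (\sum_(i < k) eps_exp k (s i)).
Proof. by rewrite -prodrXr; apply: eq_bigr => i _; rewrite eps_expE. Qed.

(** A step raises one entry x to x + 1, so it changes the total exponent by 0 or 1,
    and it preserves or reverses the sign accordingly. Hence the total exponent,
    shifted to vanish on the base symbol, obeys the recursion that characterises
    [eta]. *)
Lemma etaE k n (s : schubert k n) :
  (eta k n s + \sum_(i < k) eps_exp k i.+1 = \sum_(i < k) eps_exp k (s i))%N.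
Proof.
pose h (r : schubert k n) := (\sum_(i < k) eps_exp k (r i))%N.
pose h0 := (\sum_(i < k) eps_exp k i.+1)%N.
have h_ge r : (h0 <= h r)%N by apply: leq_sum => i _; apply/leq_eps_exp/entry_ge.
suff <- : [ffun r => (h r - h0)%N] = eta k n by rewrite ffunE subnK ?h_ge.
have h_step (r r' : schubert k n) : step r r' ->
    exists b : bool, h r' = (h r + b)%N /\ eps_symb r' = (-1) ^+ b * eps_symb r.
  case/existsP=> i /forallP r'E.
  have [b bE] := eps_expS k (leq_ltn_trans (leq0n i) (entry_ge r i)).
  exists b; suff hE : h r' = (h r + b)%N by rewrite !eps_symbE -/(h r') hE addnC exprD.
  rewrite /h (bigD1 i) //= [in RHS](bigD1 i) //= (eqP (r'E i)) eqxx addn1 bE addnAC.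
  by congr (_ + _ + _)%N; apply: eq_bigr => j /negPf ne_ji; rewrite (eqP (r'E j)) ne_ji addn0.
apply: eta_unique (etaP k n); apply/and3P; split; apply/forallP => r.
- apply/implyP => /forallP rE; rewrite ffunE /h.
  by rewrite (eq_bigr (fun i : 'I_k => eps_exp k i.+1)) ?subnn // => i _; rewrite (eqP (rE i)).
- apply/forallP => r'; apply/implyP => /andP[/h_step[b [hE eE]]]; rewrite !ffunE hE eE.
  by case: b {hE eE}; rewrite /= ?addn0 ?mulN1r //; case: (eps_symb_cases r) => ->.
apply/forallP => r'; apply/implyP => /andP[/h_step[b [hE eE]]]; rewrite !ffunE hE eE.
by case: b {hE eE}; rewrite /= ?addn1 ?mul1r ?subSn //; case: (eps_symb_cases r) => ->.
Qed.

Lemma lenE k n (s : schubert k n) :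
  (len s + \sum_(i < k) i.+1 = \sum_(i < k) s i)%N.
Proof. by rewrite -big_split; apply: eq_bigr => i _; rewrite /= subnK ?entry_ge. Qed.

Definition weight (F : fieldType) (z : F) k x : F := (-1) ^+ x * z ^+ eps_exp k x.

(** Up to the product of the weights of the base symbol, which is the same for all
    symbols, each term of [pq] is a product of weights of entries, because [len]
    and [eta] are sums over the entries. *)
Lemma pq_coef k n :
  pq k n * \prod_(x < k) weight q k x.+1
    = (\prod_(x < n) (1 + weight q k x.+1 *: 'X))`_k.
Proof.
rewrite -sum_schubert /pq /p rmorph_sum mulr_suml; apply: eq_bigr => s _.
rewrite /weight !big_split /= !prodrXr rmorphM !rmorphXn rmorphN1 -/q.
by rewrite mulrACA -!exprD lenE etaE.
Qed.

(** * Pairing conjugate factors *)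

Lemma prod_double (R : comPzRingType) (f : nat -> R) m :
  \prod_(i < 2 * m) f i = \prod_(i < m) (f (2 * i)%N * f (2 * i).+1).
Proof.
elim: m => [|m IHm]; first by rewrite muln0 !big_ord0.
by rewrite mulnS big_ord_recr big_ord_recr /= IHm [in RHS]big_ord_recr /= mulrA.
Qed.

(** The parameters [c] = 1 and [c] = [x] give the two pairings of consecutive
    weights; the result is a product to which [coef_prod_geom] applies, evaluated
    at X ^ 2. *)
Lemma prod_conj_factors (R : comNzRingType) (c x : R) m :
  \prod_(i < m) ((1 - (c * x ^+ i) *: 'X) * (1 + (c * x ^+ i) *: 'X))
    = (\prod_(i < m) (1 + (- c ^+ 2 * (x ^+ 2) ^+ i) *: 'X)) \Po 'X^2 :> {poly R}.
Proof.
rewrite rmorph_prod; apply: eq_bigr => i _ /=.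
rewrite comp_polyD comp_polyZ comp_polyX comp_polyC -subr_sqr expr1n.
by rewrite exprZn mulNr scaleNr exprMn -!exprM mulnC.
Qed.

Lemma coef_compX2_even (R : comNzRingType) (P : {poly R}) (a : R) j :
  ((P \Po 'X^2) * (1 + a *: 'X))`_(2 * j) = P`_j.
Proof.
rewrite mulrDr mulr1 -scalerAr coefD coefZ coefMX !coef_comp_poly_Xn //.
rewrite dvdn_mulr // mulKn //; case: j => [|j]; first by rewrite muln0 mulr0 addr0.
by rewrite mulnS /= dvdn2 /= oddM mulr0 addr0.
Qed.

(** The odd part of (1 + a X) (1 + b X) is (a + b) X. *)
Lemma coef_compX2_odd (R : comNzRingType) (P : {poly R}) (a b : R) j :
  ((1 + a *: 'X) * (P \Po 'X^2) * (1 + b *: 'X))`_(2 * j + 1) = (a + b) * P`_j.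
Proof.
rewrite mulrAC mulrC.
have -> : (1 + a *: 'X) * (1 + b *: 'X) = 1 + (a * b) *: 'X^2 + (a + b) *: 'X :> {poly R}.
  by rewrite -!mul_polyC polyCM polyCD; ring.
rewrite mulrDr -scalerAr coefD coefZ coefMX addn1 /= coef_comp_poly_Xn //.
rewrite dvdn_mulr // mulKn //.
have -> : (P \Po 'X^2) * (1 + (a * b) *: 'X^2) = (P * (1 + (a * b) *: 'X)) \Po 'X^2.
  by rewrite comp_polyM comp_polyD comp_polyZ comp_polyX comp_polyC.
by rewrite coef_comp_poly_Xn // dvdn2 /= oddM add0r.
Qed.

Section Weights.
Context (F : fieldType) (z : F).

(** The coefficient is written - (1 ^+ 2) to match the case c = 1 of
    [prod_conj_factors]. *)
Lemma weight_prod_even k m : ~~ odd k ->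
  \prod_(x < 2 * m) (1 + weight z k x.+1 *: 'X)
    = (\prod_(i < m) (1 + (- (1 ^+ 2) * (z ^+ 2) ^+ i) *: 'X)) \Po 'X^2.
Proof.
move=> /negPf even_k; rewrite (prod_double (fun x => 1 + weight z k x.+1 *: 'X)).
rewrite -prod_conj_factors.
apply: eq_bigr => i _; rewrite /weight /eps_exp even_k mul1r /=.
rewrite -signr_odd -[in X in _ * X]signr_odd /= oddM mul2n doubleK uphalf_double.
by rewrite expr1 expr0 mulN1r scaleNr mul1r.
Qed.

Lemma weight_base_even k j : ~~ odd k ->
  \prod_(x < 2 * j) weight z k x.+1 = \prod_(i < j) (- (1 ^+ 2) * (z ^+ 2) ^+ i).
Proof.
move=> /negPf even_k; rewrite (prod_double (fun x => weight z k x.+1)).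
apply: eq_bigr => i _; rewrite /weight /eps_exp even_k /=.
rewrite -signr_odd -[in X in _ * X]signr_odd /= oddM mul2n doubleK uphalf_double.
by rewrite expr1 expr0 expr1n !mulN1r mul1r mulNr -expr2 exprAC.
Qed.

(** The factor of x = 1 is unpaired, and the pairs start at x = 2. *)
Lemma weight_prod_odd k m : odd k ->
  \prod_(x < 2 * m + 1) (1 + weight z k x.+1 *: 'X)
    = (1 + (- 1) *: 'X) *
      ((\prod_(i < m) (1 + (- z ^+ 2 * (z ^+ 2) ^+ i) *: 'X)) \Po 'X^2).
Proof.
move=> odd_k; rewrite addn1 big_ord_recl {1}/weight {1}/eps_exp odd_k expr1 mulr1.
congr (_ * _); rewrite (prod_double (fun x => 1 + weight z k x.+2 *: 'X)).
rewrite -prod_conj_factors.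
apply: eq_bigr => i _; rewrite mulrC /weight /eps_exp odd_k /=.
rewrite -signr_odd -[in X in _ * X]signr_odd /= oddM mul2n doubleK uphalf_double.
by rewrite expr1 expr0 mulN1r scaleNr mul1r exprS.
Qed.

Lemma weight_base_odd k j : odd k ->
  \prod_(x < 2 * j + 1) weight z k x.+1
    = - \prod_(i < j) (- z ^+ 2 * (z ^+ 2) ^+ i).
Proof.
move=> odd_k; rewrite addn1 big_ord_recl {1}/weight {1}/eps_exp odd_k expr1 mulr1 mulN1r.
congr (- _); rewrite (prod_double (fun x => weight z k x.+2)).
apply: eq_bigr => i _; rewrite /weight /eps_exp odd_k /=.
rewrite -signr_odd -[in X in _ * X]signr_odd /= oddM mul2n doubleK uphalf_double.
by rewrite expr1 expr0 exprAC exprS; ring.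
Qed.

Hypothesis z_neq0 : z != 0.
Hypothesis z_nonroot : forall i, (0 < i)%N -> 1 - z ^+ i != 0.

Lemma sqr_nonroot i : (0 < i)%N -> 1 - (z ^+ 2) ^+ i != 0.
Proof. by move=> i_gt0; rewrite -exprM z_nonroot // muln_gt0. Qed.

Lemma weight_base_neq0 k : \prod_(x < k) weight z k x.+1 != 0.
Proof.
apply/prodf_neq0 => i _; apply: mulf_neq0; last exact: expf_neq0.
by rewrite signr_eq0.
Qed.

(** The factor 1 + a X stands for the unpaired last weight, or for 1 when a = 0. *)
Lemma coef_weight_even k a m j : ~~ odd k -> (j <= m)%N ->
  ((\prod_(x < 2 * m) (1 + weight z k x.+1 *: 'X)) * (1 + a *: 'X))`_(2 * j)
    = qbinom (z ^+ 2) m j * \prod_(x < 2 * j) weight z k x.+1.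
Proof.
move=> even_k le_jm; rewrite weight_prod_even // weight_base_even //.
by rewrite coef_compX2_even (coef_prod_geom sqr_nonroot) // mulrC.
Qed.

Lemma coef_weight_odd k b m j : odd k -> (j <= m)%N ->
  ((\prod_(x < 2 * m + 1) (1 + weight z k x.+1 *: 'X)) * (1 + b *: 'X))`_(2 * j + 1)
    = (1 - b) * qbinom (z ^+ 2) m j * \prod_(x < 2 * j + 1) weight z k x.+1.
Proof.
move=> odd_k le_jm; rewrite weight_prod_odd // weight_base_odd // coef_compX2_odd.
by rewrite (coef_prod_geom sqr_nonroot) //; ring.
Qed.

End Weights.

(** * The four cases *)

Lemma q_nonroot i : (0 < i)%N -> 1 - q ^+ i != 0.
Proof.
move=> i_gt0; rewrite /q -rmorphXn -(rmorph1 (tofrac (R := {poly int}))) -rmorphB /= tofrac_eq0.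
by rewrite subr_eq0 eq_sym -(subr_eq0) -size_poly_eq0 size_XnsubC.
Qed.

Lemma q_neq0 : q != 0.
Proof. by rewrite tofrac_eq0 polyX_eq0. Qed.

Lemma pq_eq k n r :
    (\prod_(x < n) (1 + weight q k x.+1 *: 'X))`_k
      = r * \prod_(x < k) weight q k x.+1 ->
  pq k n = r.
Proof. by move=> rE; apply: (mulIf (weight_base_neq0 q_neq0 k)); rewrite pq_coef. Qed.

Theorem theorem8p2 (j m : nat) :
  [/\ (1 <= 2 * j <= 2 * m)%N ->
        pq (2 * j) (2 * m) = qbinom (q ^+ 2) m j,
      (1 <= 2 * j <= 2 * m + 1)%N ->
        pq (2 * j) (2 * m + 1) = qbinom (q ^+ 2) m j,
      (1 <= 2 * j + 1 <= 2 * m + 1)%N ->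
        pq (2 * j + 1) (2 * m + 1) = qbinom (q ^+ 2) m j
    & (1 <= 2 * j + 1 <= 2 * m)%N ->
        pq (2 * j + 1) (2 * m) = (1 - q ^+ m) * qbinom (q ^+ 2) (m - 1) j].
Proof.
have even2 i : ~~ odd (2 * i) by rewrite oddM.
have odd2 i : odd (2 * i + 1) by rewrite addn1 /= even2.
have even_case a := coef_weight_even q_nonroot a (even2 j) (m := m) (j := j).
have odd_case b l := coef_weight_odd q_nonroot b (odd2 j) (m := l) (j := j).
split=> /andP[_ le_kn]; apply: pq_eq.
- have le_jm : (j <= m)%N by lia.
  by rewrite -(even_case 0) // scale0r addr0 mulr1.
- have le_jm : (j <= m)%N by lia.
  rewrite -(even_case (weight q (2 * j) (2 * m).+1)) //.
  by rewrite addn1 big_ord_recr.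
- have le_jm : (j <= m)%N by lia.
  have := odd_case 0 m le_jm.
  by rewrite scale0r addr0 mulr1 subr0 mul1r.
case: m le_kn {even_case} => [|l]; first by lia.
move=> le_kn; have le_jl : (j <= l)%N by lia.
have last_weight : weight q (2 * j + 1) (2 * l + 1).+1 = q ^+ l.+1.
  rewrite /weight /eps_exp odd2 -signr_odd /= odd2 expr0 mul1r.
  by rewrite -[uphalf _]/((2 * l + 1).+1./2) addn1 -[_.+2]/(2 + 2 * l)%N -mulnS mul2n doubleK.
rewrite subn1 -(odd_case _ _ le_jl) -last_weight.
have -> : (2 * l.+1 = (2 * l + 1).+1)%N by lia.
by rewrite big_ord_recr.
Qed.
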